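(* Let $n\ge 3$ and let $M_{\mathrm{Diag}(n)}=\langle x_iy_jz_k:\ 1\le i<j<k\le n\rangle\subset K[x_1,\dots,x_n,y_1,\dots,y_n,z_1,\dots,z_n]$. Then for every $\ell\ge 0$ the Betti numbers of $M_{\mathrm{Diag}(n)}$ are $$\beta_\ell(M_{\mathrm{Diag}(n)})=\sum_{k=3}^{n}\binom{k-1}{2}\binom{k-3}{\ell}.$$
   Context: $K$ is a field. For an ideal $M$ of the polynomial ring $R=K[x_1,\dots,x_n,y_1,\dots,y_n,z_1,\dots,z_n]$, $\beta_\ell(M)$ denotes the $\ell$-th total Betti number of $M$ regarded as an $R$-module, i.e. the rank of the $\ell$-th free module in the minimal graded free resolution of $M$; in particular $\beta_0(M)$ is the minimal number of generators of $M$. *)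

(* Defs.v *)
From Stdlib Require Import ClassicalEpsilon.
From mathcomp Require Import all_boot all_order all_algebra.
From mathcomp Require Import mpoly.

Set Implicit Arguments.
Unset Strict Implicit.
Unset Printing Implicit Defensive.

Import GRing.Theory.
Local Open Scope ring_scope.

(* Rows are the free modules' elements: F_l is the graded free module of row
   vectors of length [rk l] whose i-th basis vector has degree [shift l i], and
   [diff l : F_(l+1) -> F_l], [aug : F_0 -> R] act by right multiplication.
   F_l may be zero, and the complex is not required to be bounded. *)
Record free_complex (K : fieldType) (N : nat) := FreeComplex {
  rk : nat -> nat;
  shift : forall l, 'I_(rk l) -> int;
  aug : 'cV[{mpoly K[N]}]_(rk 0);
  diff : forall l, 'M[{mpoly K[N]}]_(rk l.+1, rk l) }.

Section Betti.
Variables (K : fieldType) (N : nat).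
Local Notation R := {mpoly K[N]}.
Implicit Types (I : R -> Prop) (F : free_complex K N).

(* Homogeneity for an integer degree: 0 is homogeneous of every degree, and is
   the only element of negative degree. *)
Definition homog_of (e : int) (p : R) : Prop :=
  forall m, m \in msupp p -> (mdeg m)%:Z = e.

(* Maps of degree 0, with R generated in degree 0. *)
Definition is_graded F : Prop :=
  (forall i, homog_of (shift i) (aug F i 0)) /\
  (forall l (i : 'I_(rk F l.+1)) (j : 'I_(rk F l)),
     homog_of (shift i - shift j) (diff F l i j)).

Definition is_resolution I F : Prop :=
  [/\ forall p, I p <-> exists u : 'rV_(rk F 0), p = (u *m aug F) 0 0,
      forall u : 'rV_(rk F 0),
        u *m aug F = 0 <-> exists w, u = w *m diff F 0
    & forall l (u : 'rV_(rk F l.+1)),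
        u *m diff F l = 0 <-> exists w, u = w *m diff F l.+1].

(* diff maps F_(l+1) into m F_l, where m is the ideal generated by the
   variables, i.e. the polynomials with zero constant coefficient. *)
Definition is_minimal F : Prop :=
  forall l (i : 'I_(rk F l.+1)) (j : 'I_(rk F l)), (diff F l i j)@_0%MM = 0.

Definition minimal_graded_free_resolution I F : Prop :=
  [/\ is_graded F, is_resolution I F & is_minimal F].

(* Meaningful for homogeneous ideals, which have a minimal graded free
   resolution, unique up to isomorphism; unspecified otherwise. *)
Definition betti I (l : nat) : nat :=
  epsilon (inhabits 0%N)
    (fun b => exists F, minimal_graded_free_resolution I F /\ rk F l = b).

Definition ideal_gen (T : finType) (A : {set T}) (g : T -> R) : R -> Prop :=
  fun p => exists c : T -> R, p = \sum_(t in A) c t * g t.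

End Betti.

Section Diag.
Variables (K : fieldType) (n : nat).

(* The 3n variables in the order x, y, z; indices run over 0, ..., n-1. *)
Definition xvar (i : 'I_n) : {mpoly K[n + n + n]} := 'X_(lshift n (lshift n i)).
Definition yvar (i : 'I_n) : {mpoly K[n + n + n]} := 'X_(lshift n (rshift n i)).
Definition zvar (i : 'I_n) : {mpoly K[n + n + n]} := 'X_(rshift (n + n) i).

Definition M_Diag : {mpoly K[n + n + n]} -> Prop :=
  ideal_gen [set t : 'I_n * 'I_n * 'I_n | (t.1.1 < t.1.2 < t.2)%N]
            (fun t => xvar t.1.1 * yvar t.1.2 * zvar t.2).

End Diag.

Arguments M_Diag : clear implicits.

(* Main.v *)
Require Import Defs.
From mathcomp Require Import all_boot all_order all_algebra.
From mathcomp Require Import mpoly ring zify.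

(** The ideal has an explicit linear resolution, the complex of boxes.  Call a
    set of variables a box when it is A, B, C with A nonempty among the x, B
    among the y, C among the z, and all indices of A below all indices of B,
    themselves below all indices of C.  The boxes with three elements are the
    generators [x_i y_j z_k], and the boxes with [l + 3] elements form a basis
    of the [l]-th free module; the differential is the Koszul one, dropping one
    variable at a time and keeping only the terms that are still boxes.  A box
    is a cell of a product of three simplices, its label is the product of its
    elements, and the complex is the cellular resolution.  Since dropping a
    variable multiplies by that variable, the complex is minimal.

    Exactness is checked one multidegree at a time.  In multidegree [m] only
    the boxes contained in the support [T] of [m] matter, and the strand is a
    complex of vector spaces ([strand_boundary]).  Given a cycle, let [a] be the
    least element of the first colour that occurs in it: [a |: S] is a box for
    every [S] in the support of the cycle, so coning over [a] moves the cycle, up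
    to a boundary, onto the boxes with [a] as only element of the first colour
    ([boundary_cone]).  The second and third colours are then treated in the
    same way ([cone_off_colours]), and at most one box, with one element of each
    colour, is left; this can happen only in homological degree 0, where a
    vanishing augmentation forces its coefficient to be zero
    ([box_chain_exact]).

    The ranks of two minimal resolutions agree because chain maps lifting the
    identity are, modulo the variables, inverse to each other
    ([homotopic_liftsP]); so [betti] is the number of boxes with [l + 3]
    elements.  A recursion on the largest admissible index gives
    ['C(n, l + 3) * 'C(l + 2, 2)] for that number ([card_boxes]): choose the
    [l + 3] indices, then the two places where the colour changes.  The sum in
    the theorem is this closed form, by the hockey-stick identity
    ([sum_binomials]).

    Boxes are defined for an arbitrary number [d] of colours, because both the
    coning argument and the count proceed colour by colour. *)

Set Implicit Arguments.
Unset Strict Implicit.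
Unset Printing Implicit Defensive.

Import GRing.Theory.
Local Open Scope ring_scope.

(** * Boxes *)

Section Boxes.
Variables N n : nat.
Implicit Types (S T : {set 'I_N}) (v w : 'I_N).

(** The variables come in blocks of length [n], one block for each colour, so
    that the colour is nondecreasing along the order of the variables. *)
Definition colour v : nat := v %/ n.
Definition position v : nat := v %% n.

Definition is_box d S :=
  [&& [forall v in S, colour v < d],
      [forall v in S, forall w in S,
         (colour v < colour w) ==> (position v < position w)]
    & [forall c : 'I_d, exists v in S, colour v == c]]%N.

Lemma boxP d S :
  reflect [/\ forall v, v \in S -> (colour v < d)%N,
              forall v w, v \in S -> w \in S -> (colour v < colour w)%N ->
                (position v < position w)%N
            & forall c, (c < d)%N -> exists2 v, v \in S & colour v = c]
          (is_box d S).
Proof.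
apply: (iffP and3P) => -[h1 h2 h3]; split.
- exact/forall_inP.
- by move=> v w vS wS; move/forall_inP/(_ v vS)/forall_inP/(_ w wS)/implyP: h2.
- move=> c lt_cd; move/forallP/(_ (Ordinal lt_cd)): h3.
  by case/exists_inP=> v vS /eqP; exists v.
- exact/forall_inP.
- apply/forall_inP=> v vS; apply/forall_inP=> w wS; apply/implyP; exact: h2.
- apply/forallP=> c; have [v vS cv] := h3 c (ltn_ord c).
  by apply/exists_inP; exists v => //; apply/eqP.
Qed.

(** Emptiness of a colour is lost by growing, order violations are lost by
    shrinking; this is what makes the truncated Koszul differential square to
    zero. *)
Lemma box_convex d S1 S2 S3 :
  is_box d S1 -> is_box d S3 -> S1 \subset S2 -> S2 \subset S3 -> is_box d S2.
Proof.
move=> /boxP[_ _ h1] /boxP[h2 h3 _] /subsetP s12 /subsetP s23.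
apply/boxP; split.
- by move=> v /s23/h2.
- by move=> v w /s23 vS /s23 wS; apply: h3.
- by move=> c /h1[v /s12 vS cv]; exists v.
Qed.

Lemma box_setD1 d S v w :
  is_box d S -> w \in S -> w != v -> colour w = colour v -> is_box d (S :\ v).
Proof.
move=> /boxP[h1 h2 h3] wS wv cw; apply/boxP; split.
- by move=> u /setD1P[_ /h1].
- by move=> u u' /setD1P[_ uS] /setD1P[_ u'S]; apply: h2.
- move=> c /h3[u uS cu]; have [uv | uv] := eqVneq u v; last first.
    by exists u => //; rewrite !inE uv.
  by exists w; rewrite ?inE ?wv // cw -uv.
Qed.

Definition colours_below c S := [set v in S | (colour v < c)%N].

Lemma colours_below_box d S : is_box d S -> colours_below d S = S.
Proof.
move=> /boxP[h _ _]; apply/setP=> v; rewrite !inE.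
by case vS: (v \in S) => //=; rewrite h.
Qed.

Lemma leq_card_colours_below d c S : is_box d S -> (c <= d)%N -> (c <= #|colours_below c S|)%N.
Proof.
move=> /boxP[_ _ h] lecd.
rewrite -[X in (X <= _)%N](size_iota 0) cardE -(size_map colour).
apply: uniq_leq_size; first exact: iota_uniq.
move=> i; rewrite mem_iota /= add0n => ltic.
have [v vS cv] := h i (leq_trans ltic lecd).
by apply/mapP; exists v => //; rewrite mem_enum !inE vS cv.
Qed.

Lemma leq_card_box d S : is_box d S -> (d <= #|S|)%N.
Proof. by move=> bS; rewrite -(colours_below_box bS) (leq_card_colours_below bS). Qed.

(** Pigeonhole: one element more than there are colours. *)
Lemma box_repeated_colour d S :
    is_box d S -> #|S| = d.+1 ->
  exists v w, [/\ v \in S, w \in S, (v < w)%N & colour v = colour w].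
Proof.
move=> /boxP[h _ _] cS.
have /(uniqPn 0%N) : ~~ uniq (map colour (enum S)).
  apply/negP=> /uniq_leq_size/(_ (_ : {subset _ <= iota 0 d})).
  rewrite size_map size_iota -cardE cS ltnn => hF; apply: notF; apply: hF.
  move=> _ /mapP[v + ->]; rewrite mem_enum mem_iota /= => /h.
  by rewrite add0n.
rewrite size_map => -[i [j [ltij ltj]]].
have lti := ltn_trans ltij ltj.
have [v0 _] : exists v0, v0 \in S by apply/set0Pn; rewrite -card_gt0 cS.
rewrite !(nth_map v0) // => eqc.
set v := nth v0 _ i in eqc; set w := nth v0 _ j in eqc.
have vS : v \in S by rewrite -mem_enum mem_nth.
have wS : w \in S by rewrite -mem_enum mem_nth.
have : v != w by rewrite nth_uniq ?enum_uniq // ltn_eqF.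
by rewrite neq_ltn => /orP[ltvw | ltwv]; [exists v, w | exists w, v].
Qed.

(** * The boundary operator *)

Section Boundary.
Variables (A : comNzRingType) (d : nat).
Implicit Types (x : 'I_N -> A) (g h : {set 'I_N} -> A).

Definition sgn v S : A := (-1) ^+ #|[set w in S | (w < v)%N]|.

Lemma sgn_sqr v S : sgn v S * sgn v S = 1.
Proof. by rewrite /sgn -exprD addnn -mul2n exprM sqrrN !expr1n. Qed.

Lemma sgnU1 v w S :
  w \notin S -> sgn v (w |: S) = (-1) ^+ (w < v)%N * sgn v S.
Proof.
move=> wS; rewrite /sgn -exprD; congr (_ ^+ _).
have -> : [set u in w |: S | (u < v)%N]
  = if (w < v)%N then w |: [set u in S | (u < v)%N] else [set u in S | (u < v)%N].
  apply/setP=> u; have [lt | lt] := boolP (w < v)%N; rewrite !inE.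
    by case: (eqVneq u w) => [->|//]; rewrite lt.
  by case: (eqVneq u w) => [->|//]; rewrite (negbTE lt) !andbF.
by case: ifP => //= _; rewrite cardsU1 !inE (negbTE wS).
Qed.

Lemma sgnU1_id v S : sgn v (v |: S) = sgn v S.
Proof.
rewrite /sgn; congr (_ ^+ _); apply: eq_card => u; rewrite !inE.
by case: eqVneq => [->|] //=; rewrite ltnn andbF.
Qed.

(** The coefficient of [S] in the boundary of the chain [g], where [x v] is the
    coefficient picked up by dropping [v].  Taking [x v] to be the variable
    gives the complex of free modules, and [x v = 1] gives its multigraded
    strands. *)
Definition boundary x g S : A :=
  if is_box d S then \sum_(v | v \notin S) sgn v S * x v * g (v |: S) else 0.

Definition box_supported g := forall S, g S != 0 -> is_box d S.

Lemma antisym_sum0 (f : 'I_N -> 'I_N -> A) :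
    (forall v, f v v = 0) -> (forall v w, f v w = - f w v) ->
  \sum_v \sum_w f v w = 0.
Proof.
move=> f0 fN.
have split_sum : \sum_v \sum_w f v w =
    \sum_(v : 'I_N) \sum_(w : 'I_N | (w < v)%N) f v w
      + \sum_(v : 'I_N) \sum_(w : 'I_N | (v < w)%N) f v w.
  rewrite -big_split; apply: eq_bigr => v _ /=.
  rewrite (bigID (fun w : 'I_N => (w < v)%N)) /=; congr (_ + _).
  rewrite (bigD1 v) ?ltnn //= f0 add0r; apply: eq_bigl => w.
  by rewrite -leqNgt ltn_neqAle andbC (inj_eq val_inj) eq_sym.
rewrite split_sum (exchange_big_dep predT) //= -big_split big1 // => v _ /=.
by rewrite -big_split big1 // => w _; rewrite /= fN addNr.
Qed.

Lemma boundary_boundary x g S :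
  box_supported g -> boundary x (boundary x g) S = 0.
Proof.
move=> supp_g; rewrite {1}/boundary; case: ifP => // bS.
pose f v w : A :=
  if [&& v != w, v \notin S & w \notin S]
  then sgn v S * x v * (sgn w (v |: S) * x w * g (w |: (v |: S))) else 0.
rewrite -[RHS](antisym_sum0 (f := f)).
- rewrite big_mkcond; apply: eq_bigr => v _.
  case: ifPn => vS; last first.
    by rewrite big1 // => w _; rewrite /f (negbTE vS) andbF.
  rewrite /boundary; case: ifPn => bvS; last first.
    rewrite mulr0 big1 // => w _; rewrite /f; case: ifP => // _.
    case: (eqVneq (g (w |: (v |: S))) 0) => [->|/supp_g bwvS]; first by rewrite !mulr0.
    by case/negP: bvS; apply: box_convex bS bwvS _ _; rewrite subsetUr.
  rewrite mulr_sumr big_mkcond; apply: eq_bigr => w _.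
  by rewrite /f vS !inE negb_or eq_sym; case: ifP.
- by move=> v; rewrite /f eqxx.
move=> v w; rewrite /f eq_sym; case: (eqVneq w v) => [_|wv]; first by rewrite oppr0.
rewrite /= [X in _ = - if X then _ else _]andbC.
case: ifP => [/andP[vS wS]|_]; last by rewrite oppr0.
rewrite setUCA !sgnU1 //.
have [lt|lt|/val_inj eq] := ltngtP v w; last by rewrite eq eqxx in wv.
  by rewrite expr0 expr1; ring.
by rewrite expr0 expr1; ring.
Qed.

Lemma boundaryD x g h S :
  boundary x (fun S' => g S' + h S') S = boundary x g S + boundary x h S.
Proof.
rewrite /boundary; case: ifP => _; last by rewrite addr0.
by rewrite -big_split; apply: eq_bigr => v _; rewrite mulrDr.
Qed.

Lemma boundaryB x g h S :
  boundary x (fun S' => g S' - h S') S = boundary x g S - boundary x h S.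
Proof.
rewrite /boundary; case: ifP => _; last by rewrite subr0.
by rewrite -sumrB; apply: eq_bigr => v _; rewrite mulrBr.
Qed.

Lemma eq_boundary x g h : g =1 h -> boundary x g =1 boundary x h.
Proof.
move=> eq_gh S; rewrite /boundary; case: ifP => // _.
by apply: eq_bigr => v _; rewrite eq_gh.
Qed.

Lemma boundary_neq0 x g S :
  boundary x g S != 0 -> is_box d S /\ exists2 v, v \notin S & g (v |: S) != 0.
Proof.
rewrite /boundary; case: ifP => [bS|_]; last by rewrite eqxx.
move=> nz; split=> //.
case: (pickP (fun v => (v \notin S) && (g (v |: S) != 0))) => [v /andP[]|none].
  by exists v.
case/eqP: nz; rewrite big1 // => v vS.
by have := none v; rewrite vS => /negbFE/eqP->; rewrite mulr0.
Qed.

(** A box with one element in excess has exactly one colour with two elements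
    [v < w], and these are the only ones that can be dropped.  Blocks of
    colours being intervals, nothing in [S] lies between [v] and [w], so the
    two signs are opposite. *)
Lemma sum_removable_signs S :
  is_box d S -> #|S| = d.+1 ->
  \sum_(v in S | is_box d (S :\ v)) sgn v S = 0.
Proof.
move=> bS cS; have [v [w [vS wS ltvw cvw]]] := box_repeated_colour bS cS.
have nvw : v != w by rewrite neq_ltn ltvw.
have bv : is_box d (S :\ v) by apply: (box_setD1 (w := w)); rewrite // eq_sym.
have bw : is_box d (S :\ w) by apply: (box_setD1 (w := v)).
have only u : u \in S -> is_box d (S :\ u) -> (u == v) || (u == w).
  move=> uS bu; apply/negPn/negP; rewrite negb_or => /andP[uv uw].
  have /leq_card_box : is_box d (S :\ u :\ v).
    by apply: (box_setD1 (w := w)); rewrite ?inE // 1?eq_sym ?nvw ?uw.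
  have := cardsD1 v (S :\ u); have := cardsD1 u S.
  by rewrite cS uS !inE vS [v == u]eq_sym uv /= !add1n => -[->] ->; rewrite ltnn.
rewrite (bigD1 v) ?vS //= (bigD1 w) ?wS ?bw 1?eq_sym //=.
rewrite [X in _ + (_ + X)]big1 => [|u]; last first.
  move=> /andP[/andP[/andP[uS bu] uv] uw].
  by have := only u uS bu; rewrite (negbTE uv) (negbTE uw).
rewrite addr0 /sgn.
have -> : [set u in S | (u < w)%N] = v |: [set u in S | (u < v)%N].
  apply/setP=> u; rewrite !inE; case: (eqVneq u v) => [->|uv]; first by rewrite vS.
  case uS: (u \in S) => //=; apply/idP/idP => [ltuw|/ltn_trans->//].
  rewrite ltnNge leq_eqVlt eq_sym (inj_eq val_inj) (negbTE uv) /=.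
  apply/negP=> ltvu.
  have cu : colour u = colour v.
    by apply/eqP; rewrite eqn_leq {1}cvw /colour !leq_div2r // ltnW.
  have := only u uS; rewrite (negbTE uv).
  rewrite (_ : (u == w) = false); last by apply/negbTE; rewrite neq_ltn ltuw.
  by move=> hF; apply: notF; apply: hF; apply: (box_setD1 (w := v)); rewrite // eq_sym.
by rewrite cardsU1 !inE ltnn andbF add1n exprS mulN1r subrr.
Qed.

(** The map sending each minimal box to its label kills boundaries; after
    exchanging the sums, this is the cancellation of the two signs above. *)
Lemma augmentation_boundary x g :
    (forall S, g S != 0 -> is_box d S /\ #|S| = d.+1) ->
  \sum_(S : {set 'I_N}) (\prod_(v in S) x v) * boundary x g S = 0.
Proof.
move=> supp_g; pose X (S : {set 'I_N}) := \prod_(v in S) x v.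
transitivity (\sum_(S : {set 'I_N}) \sum_(v | v \notin S)
    (if is_box d S then sgn v S * g (v |: S) * X (v |: S) else 0)).
  apply: eq_bigr => S _; rewrite /boundary; case: ifP => _; last first.
    by rewrite mulr0 big1.
  rewrite mulr_sumr; apply: eq_bigr => v vS.
  by rewrite /X big_setU1 //=; ring.
transitivity (\sum_S g S * X S * \sum_(v in S | is_box d (S :\ v)) sgn v S).
  rewrite (exchange_big_dep predT) //=.
  under [RHS]eq_bigr => S _ do rewrite mulr_sumr big_mkcondr.
  rewrite [RHS](exchange_big_dep predT) //=; apply: eq_bigr => v _.
  rewrite (reindex_onto (fun S => S :\ v) (fun S => v |: S)) /=; last first.
    by move=> S vS; rewrite setU1K.
  apply: eq_big => [S|S].
    rewrite !inE eqxx /=; apply/eqP/idP => [<-|/setD1K//].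
    by rewrite !inE eqxx.
  rewrite !inE eqxx /= => /eqP eqS; rewrite eqS.
  have -> : sgn v S = sgn v (S :\ v) by rewrite -{1}eqS sgnU1_id.
  by case: ifP => // _; ring.
rewrite big1 // => S _; case: (eqVneq (g S) 0) => [->|/supp_g[bS cS]].
  by rewrite !mul0r.
by rewrite sum_removable_signs // mulr0.
Qed.

(** * Acyclicity of the strands *)

Definition cone a g S : A := if a \in S then sgn a S * g (S :\ a) else 0.

(** The difference is a cycle that vanishes on the sets without [a], by the
    choice of sign in the cone.  In its boundary at [S :\ a] only the term of
    [S] survives, so it also vanishes on [S] as soon as [S :\ a] is a box. *)
Lemma boundary_cone a g S :
    box_supported g -> (forall S, g S != 0 -> is_box d (a |: S)) ->
    (forall S, boundary (fun=> 1) g S = 0) ->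
    g S - boundary (fun=> 1) (cone a g) S != 0 ->
  a \in S /\ ~~ is_box d (S :\ a).
Proof.
move=> supp_g cone_g cycle_g.
pose g' S := g S - boundary (fun=> 1) (cone a g) S.
have supp_cone : box_supported (cone a g).
  move=> S'; rewrite /cone; case: ifP => [aS|_]; last by rewrite eqxx.
  case: (eqVneq (g (S' :\ a)) 0) => [->|/cone_g]; first by rewrite mulr0 eqxx.
  by rewrite setD1K.
have off S' : a \notin S' -> g' S' = 0.
  move=> aS; rewrite /g' /boundary; case: ifPn => [bS|]; last first.
    by move/negP=> nb; rewrite subr0; apply/eqP/negPn/negP=> /supp_g.
  rewrite (bigD1 a) //= big1 => [|v /andP[vS va]]; last first.
    by rewrite /cone !inE eq_sym (negbTE va) (negbTE aS) mulr0.
  rewrite /cone !inE eqxx /= setU1K // sgnU1_id mulr1 mulrA sgn_sqr mul1r.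
  by rewrite addr0 subrr.
have cycle_g' S' : boundary (fun=> 1) g' S' = 0.
  by rewrite boundaryB cycle_g boundary_boundary // subr0.
rewrite -/(g' S) => nz; have aS : a \in S by apply: contraNT nz => /off->.
split=> //; apply: contra nz => bS; have := cycle_g' (S :\ a).
rewrite /boundary bS (bigD1 a) ?inE ?eqxx //= setD1K // big1 => [|v].
  rewrite addr0 mulr1 => /(congr1 ( *%R (sgn a (S :\ a)))).
  by rewrite mulrA sgn_sqr mul1r mulr0 => ->.
move=> /andP[_ va]; rewrite off ?mulr0 //.
by rewrite !inE eqxx eq_sym (negbTE va).
Qed.

Definition box_chain T s g :=
  forall S, g S != 0 -> [/\ is_box d S, S \subset T & #|S| = s].

(** Each colour is used in turn as a cone point.  Once the colours below [c] are
    reduced to a common set [E], let [a] be the element of colour [c] with the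
    least position among those that occur: it lies above [E], because it occurs
    together with [E], and below all higher colours of any box in play, because
    such a box has an element of colour [c] at a position no smaller.  Hence
    [a] may be added to every box in play. *)
Lemma cone_off_colours T s g c :
    box_chain T s g -> (forall S, boundary (fun=> 1) g S = 0) -> (c <= d)%N ->
  exists h E, box_chain T s.+1 h /\
    forall S, g S - boundary (fun=> 1) h S != 0 -> colours_below c S = E /\ #|E| = c.
Proof.
move=> chain_g cycle_g; elim: c => [|c IHc] lecd.
  exists (fun=> 0), set0; split=> [S|S _]; first by rewrite eqxx.
  by rewrite cards0; split=> //; apply/setP=> v; rewrite !inE andbF.
have [h [E [chain_h below_h]]] := IHc (ltnW lecd).
pose g' S := g S - boundary (fun=> 1) h S.
have chain_bd h1 : box_chain T s.+1 h1 -> box_chain T s (boundary (fun=> 1) h1).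
  move=> chain_h1 S /boundary_neq0[bS [v vS /chain_h1[_ /subsetP sub cS]]].
  split=> //; first by apply/subsetP=> w wS; apply: sub; rewrite !inE wS orbT.
  by move: cS; rewrite cardsU1 vS add1n => -[].
have chainB g1 g2 : box_chain T s g1 -> box_chain T s g2 ->
    box_chain T s (fun S => g1 S - g2 S).
  move=> ch1 ch2 S; case: (eqVneq (g1 S) 0) => [->|/ch1 //].
  by rewrite sub0r oppr_eq0 => /ch2.
have chain_g' : box_chain T s g' by apply: chainB => //; apply: chain_bd.
have cycle_g' S : boundary (fun=> 1) g' S = 0.
  by rewrite boundaryB cycle_g boundary_boundary ?subr0 // => S' /chain_h[].
pose P v := (colour v == c) && [exists S, (g' S != 0) && (v \in S)].
have [a0 Pa0|noP] := pickP P; last first.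
  exists h, E; split=> // S nz; have [/boxP[_ _ /(_ c lecd)[v vS cv]] _ _] := chain_g' S nz.
  case/negP: (noP v); rewrite /P cv eqxx /=; apply/existsP; exists S.
  by rewrite vS andbT.
case: (arg_minnP position Pa0) => a /andP[/eqP ca /existsP[S0 /andP[nz0 aS0]]] min_a.
have cone_g' S : g' S != 0 -> is_box d (a |: S).
  move=> nz; have [/boxP[h1 h2 h3] _ _] := chain_g' S nz.
  have [/boxP[_ h2' _] _ _] := chain_g' S0 nz0.
  have a_below w : w \in S -> (colour w < c)%N -> (position w < position a)%N.
    move=> wS ltw; apply: h2' => //; last by rewrite ca.
    have : w \in colours_below c S by rewrite inE wS.
    by rewrite (proj1 (below_h S nz)) -(proj1 (below_h S0 nz0)) inE => /andP[].
  have a_above w : w \in S -> (c < colour w)%N -> (position a < position w)%N.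
    move=> wS ltw; have [v vS cv] := h3 c lecd.
    apply: leq_ltn_trans (_ : position a <= position v)%N _.
      apply: min_a; rewrite /P cv eqxx /=; apply/existsP; exists S.
      by rewrite nz.
    by apply: h2 => //; rewrite cv.
  apply/boxP; split.
  - by move=> v /setU1P[->|/h1 //]; rewrite ca.
  - move=> v w /setU1P[->|vS] /setU1P[->|wS]; rewrite ?ltnn ?ca //.
    + exact: a_above.
    + exact: a_below.
    + exact: h2.
  - by move=> i /h3[v vS cv]; exists v; rewrite // !inE vS orbT.
have aT : a \in T by have [_ /subsetP sub _] := chain_g' S0 nz0; apply: sub.
have chain_cone : box_chain T s.+1 (cone a g').
  move=> S; rewrite /cone; case: ifP => [aS|_]; last by rewrite eqxx.
  case: (eqVneq (g' (S :\ a)) 0) => [->|nz _]; first by rewrite mulr0 eqxx.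
  have [_ sub cS] := chain_g' _ nz; split.
  - by rewrite -(setD1K aS) cone_g'.
  - by rewrite -(setD1K aS) subUset sub1set aT.
  - by rewrite (cardsD1 a) aS cS.
exists (fun S => h S + cone a g' S), (a |: E); split=> [S|S].
  case: (eqVneq (h S) 0) => [->|/chain_h //].
  by rewrite add0r => /chain_cone.
rewrite boundaryD opprD addrA -/(g' S) => nz.
have [|] := boundary_cone _ cone_g' cycle_g' nz; first by move=> S' /chain_g'[].
move=> aS nbox.
have [bS _ _] := chainB _ _ chain_g' (chain_bd _ chain_cone) S nz.
have below_a S' : colours_below c (S' :\ a) = colours_below c S'.
  apply/setP=> v; rewrite !inE; case: eqVneq => [->|//].
  by rewrite ca ltnn !andbF.
(* The cone does not disturb the lower colours: a term of its boundary comes from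
   dropping one element, and [E] has no element to spare. *)
have [belowS cE] : colours_below c S = E /\ #|E| = c.
  case: (eqVneq (g' S) 0) nz => [->|/below_h //].
  rewrite sub0r oppr_eq0 => /boundary_neq0[_ [v vS]].
  rewrite /cone; case: ifP => [avS|_]; last by rewrite eqxx.
  case: (eqVneq (g' ((v |: S) :\ a)) 0) => [->|/below_h]; first by rewrite mulr0 eqxx.
  rewrite below_a => -[belowE cE] _; split=> //; apply/eqP; rewrite eqEcard cE.
  rewrite (leq_card_colours_below bS (ltnW lecd)) andbT -belowE.
  by apply/subsetP=> w; rewrite !inE => /andP[-> ->]; rewrite orbT.
have belowS' : colours_below c.+1 S = a |: E.
  apply/setP=> v; rewrite -belowS !inE ltnS leq_eqVlt andb_orr orbC.
  case: (eqVneq v a) => [->|va]; first by rewrite aS ca eqxx orbT.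
  rewrite /=; case: (boolP ((v \in S) && (colour v == c))) => [/andP[vS /eqP cv]|_].
    by case/negP: nbox; apply: (box_setD1 (w := v)); rewrite // ?cv ?ca.
  by rewrite orbF.
split=> //; rewrite cardsU1 cE -belowS inE ca ltnn andbF //.
Qed.

(** After the last colour, the remaining cycle lives on the single set [E],
    which has [d] elements.  So it is zero unless [s = d], and then its value at
    [E] is the sum of its coefficients, which adding a boundary does not change. *)
Lemma box_chain_exact T s g :
    box_chain T s g -> (forall S, boundary (fun=> 1) g S = 0) ->
    (s = d -> \sum_S g S = 0) ->
  exists h, box_chain T s.+1 h /\ g =1 boundary (fun=> 1) h.
Proof.
move=> chain_g cycle_g sum_g.
have [h [E [chain_h hE]]] := cone_off_colours chain_g cycle_g (leqnn d).
exists h; split=> //.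
pose g' S := g S - boundary (fun=> 1) h S.
have suppE S : g' S != 0 -> S = E /\ s = d.
  move=> nz; have [bS cS] : is_box d S /\ #|S| = s.
    case: (eqVneq (g S) 0) nz; rewrite /g'; last by move=> /chain_g[].
    move=> ->; rewrite sub0r oppr_eq0 => /boundary_neq0[bS [v vS /chain_h[_ _]]].
    by rewrite cardsU1 vS add1n => -[].
  by have [belowE cE] := hE S nz; rewrite -cE -cS -belowE colours_below_box.
move=> S; apply/eqP; rewrite -subr_eq0; apply/negPn/negP => nz.
have [eqS sd] := suppE S nz.
have /eqP : \sum_S g' S = 0.
  rewrite sumrB sum_g // sub0r; apply/eqP; rewrite oppr_eq0; apply/eqP.
  have := @augmentation_boundary (fun=> 1) h.
  under eq_bigr do rewrite big1_eq mul1r.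
  by apply=> S' /chain_h[bS' _ ->]; rewrite sd.
rewrite (bigD1 S) //= big1 ?addr0; first by rewrite (negbTE nz).
move=> S' neq; apply/eqP/negPn/negP => /suppE[eqS' _].
by rewrite eqS eqS' eqxx in neq.
Qed.
End Boundary.

(** * The complex of boxes over the polynomial ring *)

Section Resolution.
Variables (K : fieldType) (d : nat).
Local Notation R := {mpoly K[N]}.
Local Notation X := (fun v : 'I_N => 'X_v : R).
Local Notation "1_ S" := (mesym1 S) (at level 1, format "1_ S").
Implicit Types (m : 'X_{1..N}) (U W : {set 'I_N} -> R).

Lemma mcoeffMXE (p : R) m k :
  (p * 'X_[m])@_k = if (m <= k)%MM then p@_(k - m) else 0.
Proof.
case: ifPn => [lemk|nle]; first by rewrite -{1}(submK lemk) addmC mcoeffMX.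
apply/eqP; rewrite mcoeff_eq0 (perm_mem (msuppMX _ _)).
by apply: contra nle => /mapP[k' _ ->]; exact: lem_addr.
Qed.

Definition var_support m : {set 'I_N} := [set v | m v != 0%N].

Lemma mesym1_le S m : (1_S <= m)%MM = (S \subset var_support m).
Proof.
apply/mnm_lepP/subsetP => [le v vS|sub v].
  by have := le v; rewrite mnmE vS inE -lt0n.
by rewrite mnmE; case vS: (v \in S) => //; have := sub v vS; rewrite inE -lt0n.
Qed.

Lemma mesym1U1 v S : v \notin S -> 1_(v |: S) = (1_S + U_(v))%MM.
Proof.
move=> vS; apply/mnmP=> w; rewrite mnmDE mnm1E !mnmE !inE.
by case: (eqVneq w v) => [->|]; rewrite ?(negbTE vS) // addn0.
Qed.

Lemma mpolyX_mesym1 S : 'X_[1_S] = \prod_(v in S) 'X_v :> R.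
Proof.
rewrite mpolyXE_id [RHS]big_mkcond; apply: eq_bigr => v _.
by rewrite mnmE; case: (v \in S); rewrite ?expr1 ?expr0.
Qed.

Lemma sgnC v S : sgn R v S = (sgn K v S)%:MP.
Proof. by rewrite /sgn rmorphXn /= rmorphN1. Qed.

(** The part of [U] in multidegree [m], stripped of its monomials: the basis
    vector of a box [S] has the multidegree [1_S]. *)
Definition strand m U S : K :=
  if S \subset var_support m then (U S)@_(m - 1_S) else 0.

Lemma strand_boundary m U S :
  strand m (boundary d X U) S = boundary d (fun=> 1) (strand m U) S.
Proof.
rewrite /strand /boundary; case: (is_box d S); last by rewrite mcoeff0 if_same.
case: ifPn => sub; last first.
  rewrite big1 // => v _; rewrite ifN ?mulr0 //.
  by apply: contra sub; apply: subset_trans; rewrite subsetUr.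
rewrite raddf_sum; apply: eq_bigr => v vS /=.
rewrite sgnC -mulrA mcoeffCM mulr1; congr (_ * _).
rewrite mulrC mcoeffMXE mesym1U1 // submDA; congr (if _ then _ else _).
rewrite -mesym1_le mesym1U1 //; apply/mnm_lepP/mnm_lepP => le w.
  have := le w; rewrite mnmBE mnmDE; move: sub; rewrite -mesym1_le.
  by move=> /mnm_lepP/(_ w); lia.
by have := le w; rewrite mnmBE mnmDE; lia.
Qed.

(** A chain is the sum of its multigraded components.  The bound [k] leaves room
    for the degree of [1_S], which is at most [N]. *)
Lemma sum_strand U S k :
    (msize (U S) + N <= k)%N ->
  U S = \sum_(m : 'X_{1..N < k}) strand m U S *: 'X_[m - 1_S].
Proof.
move=> lek; apply/mpolyP=> j; rewrite raddf_sum /=.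
under eq_bigr do rewrite mcoeffZ mcoeffX.
have term0 (m : 'X_{1..N}) : m != (j + 1_S)%MM -> strand m U S * ((m - 1_S)%MM == j)%:R = 0.
  move=> neq; rewrite /strand; case: ifP; last by rewrite mul0r.
  rewrite -mesym1_le => le; case: eqP => [eqj|]; last by rewrite mulr0.
  by rewrite -eqj submK // eqxx in neq.
have [lt|ge] := ltnP (mdeg (j + 1_S)%MM) k.
  rewrite (bigD1 (BMultinom lt)) //= big1 => [|m]; last by move=> /(term0 m).
  by rewrite addr0 /strand -mesym1_le lem_addl addmK eqxx mulr1.
rewrite big1 => [|m _]; last first.
  by apply: term0; apply: contraTneq (bmdeg m) => ->; rewrite -leqNgt.
apply/eqP; rewrite mcoeff_eq0; apply: msize_mdeg_ge.
move: ge; rewrite mdegD mdeg_mesym1; have := max_card S; rewrite card_ord.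
by move: lek; lia.
Qed.

(** Each strand is filled separately, and the fillings are put back together with
    their monomials. *)
Lemma resolution_exact s U :
    (forall S, U S != 0 -> is_box d S /\ #|S| = s) ->
    (forall S, boundary d X U S = 0) ->
    (s = d -> \sum_(S : {set 'I_N}) (\prod_(v in S) X v) * U S = 0) ->
  exists W, (forall S, W S != 0 -> is_box d S /\ #|S| = s.+1) /\
    U =1 boundary d X W.
Proof.
move=> supp_U cycle_U sum_U.
pose k := (\max_(S : {set 'I_N}) msize (U S) + N)%N.
have /fin_all_exists[h hh] (m : 'X_{1..N < k}) : exists h : {set 'I_N} -> K,
    box_chain d (var_support m) s.+1 h /\ strand m U =1 boundary d (fun=> 1) h.
  apply: box_chain_exact.
  - move=> S; rewrite /strand; case: ifP => [sub|_]; last by rewrite eqxx.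
    case: (eqVneq (U S) 0) => [->|/supp_U[]//]; by rewrite mcoeff0 eqxx.
  - by move=> S; rewrite -strand_boundary /strand cycle_U mcoeff0 if_same.
  move=> /sum_U/(congr1 (mcoeff m)); rewrite mcoeff0 raddf_sum /= => sum0; rewrite -[RHS]sum0.
  apply: eq_bigr => S _; rewrite -mpolyX_mesym1 mulrC mcoeffMXE.
  by rewrite /strand -mesym1_le.
pose W S : R := \sum_(m : 'X_{1..N < k}) h m S *: 'X_[m - 1_S].
exists W; split=> [S|S].
  case: (pickP (fun m : 'X_{1..N < k} => h m S != 0)) => [m /(proj1 (hh m))[]// | none].
  by rewrite /W big1 ?eqxx // => m _; move/negbFE/eqP: (none m) => ->; rewrite scale0r.
rewrite (@sum_strand U S k); last by rewrite leq_add2r (leq_bigmax S).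
under eq_bigr => m _ do rewrite (proj2 (hh m)).
rewrite /boundary; case: ifP => bS; last by rewrite big1 // => m _; rewrite scale0r.
under eq_bigr do rewrite scaler_suml.
rewrite exchange_big; apply: eq_bigr => v vS; rewrite mulr_sumr.
apply: eq_bigr => m _; rewrite mulr1.
case: (eqVneq (h m (v |: S)) 0) => [->|/(proj1 (hh m))[_ + _]].
  by rewrite mulr0 !scale0r mulr0.
rewrite -mesym1_le mesym1U1 // => le.
rewrite sgnC -mulrA mul_mpolyC -scalerA -scalerAr -mpolyXD; congr (_ *: (_ *: 'X_[_])).
apply/mnmP=> w; move/mnm_lepP/(_ w): le; rewrite !(mnmBE, mnmDE).
by lia.
Qed.

Definition boxes l := [set S : {set 'I_N} | is_box d S & #|S| == (l + d)%N].

Definition box l (i : 'I_#|boxes l|) : {set 'I_N} := enum_val i.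

Definition box_complex : free_complex K N := {|
  rk := fun l => #|boxes l|;
  shift := fun l _ => (l + d)%:Z;
  aug := \col_i \prod_(v in box i) 'X_v;
  diff := fun l => \matrix_(i, j)
    \sum_(v | (v \notin box j) && (v |: box j == box i))
      sgn R v (box j) * 'X_v |}.

(** Row vectors over the boxes are identified with functions of all sets that
    vanish outside the boxes, so that the entries of a vector can be named by
    sets rather than by ranks in an enumeration. *)
Definition chain l (u : 'rV[R]_#|boxes l|) (S : {set 'I_N}) : R :=
  \sum_i u 0 i * (box i == S)%:R.

Lemma box_in l (i : 'I_#|boxes l|) : box i \in boxes l.
Proof. exact: enum_valP. Qed.

Lemma chain_box l (u : 'rV_#|boxes l|) j : chain u (box j) = u 0 j.
Proof.
rewrite /chain (bigD1 j) //= eqxx mulr1 big1 ?addr0 // => i neq.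
by rewrite (inj_eq enum_val_inj) (negbTE neq) mulr0.
Qed.

Lemma chain_supp l (u : 'rV_#|boxes l|) S : chain u S != 0 -> S \in boxes l.
Proof.
apply: contraNT => nS; rewrite /chain big1 // => i _.
by case: eqP => [eqS|_]; [rewrite -eqS box_in in nS | rewrite mulr0].
Qed.

Lemma chain_surj l W : (forall S, W S != 0 -> S \in boxes l) ->
  exists u : 'rV_#|boxes l|, chain u =1 W.
Proof.
move=> supp_W; exists (\row_i W (box i)) => S.
have [Sl | nS] := boolP (S \in boxes l).
  by rewrite -(enum_rankK_in Sl Sl : box _ = S) chain_box mxE.
case: (eqVneq (W S) 0) (supp_W S) => [-> _|_ /(_ isT)]; last by rewrite (negbTE nS).
by apply/eqP/negPn/negP=> /chain_supp; rewrite (negbTE nS).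
Qed.

Lemma chain_inj l (u w : 'rV_#|boxes l|) : chain u =1 chain w -> u = w.
Proof. by move=> eq_uw; apply/rowP=> i; rewrite -!chain_box eq_uw. Qed.

Lemma chain0 l S : chain (0 : 'rV_#|boxes l|) S = 0.
Proof. by rewrite /chain big1 // => i _; rewrite mxE mul0r. Qed.

Lemma chain_boxP l (u : 'rV_#|boxes l|) S :
  chain u S != 0 -> is_box d S /\ #|S| = (l + d)%N.
Proof. by move/chain_supp; rewrite inE => /andP[? /eqP]. Qed.

Lemma chain_diff l (u : 'rV_#|boxes l.+1|) :
  chain (u *m diff box_complex l) =1 boundary d X (chain u).
Proof.
move=> S; have [Sl | nS] := boolP (S \in boxes l); last first.
  transitivity (0 : R); last apply/esym; apply/eqP/negPn/negP.
    by move/chain_supp; rewrite (negbTE nS).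
  move/boundary_neq0=> [bS [v vS /chain_boxP[_]]].
  rewrite cardsU1 vS add1n addSn => -[cS].
  by rewrite inE bS cS eqxx in nS.
rewrite -(enum_rankK_in Sl Sl : box _ = S) chain_box; set j := enum_rank_in Sl S.
rewrite mxE /boundary; have := box_in j; rewrite inE => /andP[-> _].
under eq_bigr => i _ do rewrite mxE mulr_sumr big_mkcondr.
rewrite (exchange_big_dep (fun v => v \notin box j)) //=.
apply: eq_bigr => v vS; rewrite [in RHS]/chain mulr_sumr; apply: eq_big => [i|i _]; first by rewrite vS.
by rewrite eq_sym; case: eqP => _; rewrite ?mulr0 // mulr1 mulrC.
Qed.

Lemma chain_aug (u : 'rV_#|boxes 0|) :
  (u *m aug box_complex) 0 0
    = \sum_(S : {set 'I_N}) (\prod_(v in S) X v) * chain u S.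
Proof.
rewrite mxE; under [RHS]eq_bigr do rewrite mulr_sumr.
rewrite [RHS]exchange_big; apply: eq_bigr => i _; rewrite mxE.
rewrite (bigD1 (box i)) //= [X in _ + X]big1 => [|S neq].
  by rewrite addr0 eqxx mulr1 mulrC.
by rewrite eq_sym (negbTE neq) !mulr0.
Qed.

Definition box_ideal : R -> Prop :=
  ideal_gen (boxes 0) (fun S => \prod_(v in S) 'X_v).

Lemma box_idealP p :
  box_ideal p <-> exists u : 'rV_#|boxes 0|, p = (u *m aug box_complex) 0 0.
Proof.
split=> [[c ->] | [u ->]].
  have [S nz | u eq_u] := @chain_surj 0 (fun S => if S \in boxes 0 then c S else 0).
    by apply: contraNT nz => /negbTE->.
  exists u; rewrite chain_aug big_mkcond; apply: eq_bigr => S _.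
  by rewrite eq_u; case: ifP => _; rewrite ?mulr0 // mulrC.
exists (chain u); rewrite chain_aug [RHS]big_mkcond; apply: eq_bigr => S _.
rewrite mulrC; case: ifPn => // nS.
case: (eqVneq (chain u S) 0) => [->|/chain_supp]; first by rewrite mul0r.
by rewrite (negbTE nS).
Qed.

Lemma box_complex_resolution (I : R -> Prop) :
  (forall p, I p <-> box_ideal p) -> is_resolution I box_complex.
Proof.
move=> hI; split=> [p|u|l u]; first by rewrite hI; apply: box_idealP.
  split=> [/rowP/(_ 0)|[w ->]].
    rewrite chain_aug mxE => sum_u.
    have [|||W [supp_W eqW]] := @resolution_exact d (chain u) => //.
    - exact: chain_boxP.
    - move=> S; apply/eqP/negPn/negP=> /boundary_neq0[/leq_card_box + [v vS]].
      by move=> + /chain_boxP[_]; rewrite cardsU1 vS add1n add0n => /[swap] <-; rewrite ltnn.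
    have [|w eqw] := @chain_surj 1 W.
      by move=> S /supp_W[bS cS]; rewrite inE bS cS eqxx.
    exists w; apply: chain_inj => S.
    by rewrite chain_diff eqW; apply: eq_boundary => S'; rewrite eqw.
  apply/matrixP=> i j; rewrite !ord1 chain_aug mxE.
  under eq_bigr do rewrite chain_diff.
  by apply: augmentation_boundary => S /chain_boxP.
split=> [u0|[w ->]]; last first.
  apply: chain_inj => S; rewrite chain0 chain_diff.
  rewrite (eq_boundary _ _ (chain_diff w)) boundary_boundary //.
  by move=> S' /chain_boxP[].
have [|||W [supp_W eqW]] := @resolution_exact (l.+1 + d) (chain u).
- exact: chain_boxP.
- by move=> S; rewrite -chain_diff u0 chain0.
- by lia.
have [|w eqw] := @chain_surj l.+2 W.
  by move=> S /supp_W[bS cS]; rewrite inE bS cS eqxx.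
exists w; apply: chain_inj => S.
by rewrite chain_diff eqW; apply: eq_boundary => S'; rewrite eqw.
Qed.

Lemma box_complex_graded : is_graded box_complex.
Proof.
split=> [i m | l i j m].
  rewrite mxE -mpolyX_mesym1 => /mem_msuppXP <-.
  rewrite mdeg_mesym1; have := box_in i; rewrite inE => /andP[_ /eqP-> //].
rewrite /= mxE => mS; suff /dhomogP/(_ m mS) -> :
    \sum_(v | (v \notin box j) && (v |: box j == box i))
      sgn R v (box j) * 'X_v \is [in K[N], 1.-homog] by lia.
apply: rpred_sum => v _; rewrite sgnC mul_mpolyC; apply: rpredZ.
by rewrite dhomogX /= mdeg1.
Qed.

Lemma box_complex_minimal : is_minimal box_complex.
Proof.
move=> l i j; rewrite mxE raddf_sum big1 // => v _ /=.
by rewrite sgnC mcoeffCM mcoeffX mnm1_eq0 mulr0.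
Qed.


End Resolution.

Lemma colour_position v c p :
  (p < n)%N -> v = (c * n + p)%N :> nat -> colour v = c /\ position v = p.
Proof.
move=> ltpn eqv; have n_gt0 := leq_ltn_trans (leq0n p) ltpn.
by rewrite /colour /position eqv divnMDl // modnMDl divn_small // addn0 modn_small.
Qed.

Lemma colour_position_inj v w :
  colour v = colour w -> position v = position w -> v = w.
Proof.
rewrite /colour /position => eqd eqm; apply: val_inj => /=.
by rewrite (divn_eq v n) eqd eqm -divn_eq.
Qed.

(** * Counting boxes *)

Definition boxes_below d m s :=
  [set S : {set 'I_N} |
     [&& is_box d S, [forall v in S, position v < m]%N & #|S| == s]].

Lemma boxes_belowP d m s S :
  reflect [/\ is_box d S, forall v, v \in S -> (position v < m)%N & #|S| = s]
          (S \in boxes_below d m s).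
Proof.
rewrite inE; apply: (iffP and3P) => -[bS h /eqP cS]; split=> //; exact/forall_inP.
Qed.

(** Only an element [t] of the last colour can sit at the last position [m],
    since some element of the last colour lies beyond all others.  Removing [t]
    leaves a box with the same colours, or one colour fewer when [t] was alone
    in its colour. *)
Lemma card_boxes_below_rec d m s :
    (d.+1 * n <= N)%N -> (m < n)%N ->
  #|boxes_below d.+1 m.+1 s.+1|
    = (#|boxes_below d.+1 m s.+1| + (#|boxes_below d.+1 m s| + #|boxes_below d m s|))%N.
Proof.
move=> leN ltm.
have ltN : (d * n + m < N)%N by apply: leq_trans leN; rewrite mulSn addnC ltn_add2r.
have [ct pt] : colour (Ordinal ltN) = d /\ position (Ordinal ltN) = m.
  exact: colour_position.
move: (Ordinal ltN) ct pt => t ct pt {ltN}.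
have is_t v : colour v = d -> position v = m -> v = t.
  by move=> cv pv; apply: colour_position_inj; rewrite ?ct ?pt.
set A := boxes_below d.+1 m.+1 s.+1; set B := boxes_below d.+1 m s.
set C := boxes_below d m s.
have tNBC S : S \in B :|: C -> t \notin S.
  by case/setUP=> /boxes_belowP[_ h _]; apply/negP => /h; rewrite pt ltnn.
rewrite -(cardsID [set S : {set 'I_N} | t \in S] A) addnC; congr (_ + _)%N.
  apply: eq_card => S; rewrite in_setD inE; apply/andP/boxes_belowP.
    case=> tS /boxes_belowP[bS pS cS]; split=> // v vS; move/boxP: (bS) => [h1 h2 h3].
    have := pS v vS; rewrite ltnS leq_eqVlt => /orP[/eqP pv|//].
    have := h1 v vS; rewrite ltnS leq_eqVlt => /orP[/eqP cv|ltv].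
      by rewrite (is_t v) // in vS; rewrite vS in tS.
    have [w wS cw] := h3 d (ltnSn d).
    have := h2 v w vS wS; rewrite cw pv => /(_ ltv); rewrite ltnNge.
    by have := pS w wS; rewrite ltnS => ->.
  case=> bS pS cS; split; first by apply/negP=> /pS; rewrite pt ltnn.
  by apply/boxes_belowP; split=> // v /pS/ltnW.
have -> : (#|B| + #|C|)%N = #|B :|: C|.
  rewrite cardsU (_ : B :&: C = set0) ?cards0 ?subn0 //.
  apply/setP=> S; rewrite !inE; apply/negP.
  case/andP=> /and3P[/boxP[_ _ /(_ d (ltnSn d))[v vS cv]] _ _].
  by case/and3P=> /boxP[/(_ v vS)]; rewrite cv ltnn.
have inj_t : {in B :|: C &, injective (fun S => t |: S)}.
  by move=> S S' /tNBC tS /tNBC tS' eqS; rewrite -(setU1K tS) eqS setU1K.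
rewrite -(card_in_imset inj_t).
apply: eq_card => S; apply/setIP/imsetP.
  case=> /boxes_belowP[bS pS cS]; rewrite in_set => tS; exists (S :\ t); last by rewrite setD1K.
  move/boxP: (bS) => [h1 h2 h3].
  have cS' : #|S :\ t| = s by move: cS; rewrite (cardsD1 t) tS add1n => -[].
  have pS' v : v \in S :\ t -> (position v < m)%N.
    rewrite !inE => /andP[vt vS].
    have := pS v vS; rewrite ltnS leq_eqVlt => /orP[/eqP pv|//].
    have := h1 v vS; rewrite ltnS leq_eqVlt => /orP[/eqP cv|ltv].
      by rewrite (is_t v) ?eqxx in vt.
    by have := h2 v t vS tS; rewrite ct pt => /(_ ltv).
  case: (pickP (fun v => (v \in S :\ t) && (colour v == d))) => [w /andP[wS /eqP cw]|none].
    apply/setUP; left; apply/boxes_belowP; split=> //.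
    by move: wS; rewrite !inE => /andP[wt wS]; apply: (box_setD1 (w := w)); rewrite // cw.
  apply/setUP; right; apply/boxes_belowP; split=> //; apply/boxP; split.
  - move=> v vS; have := none v; rewrite vS /= => /negbT ncv.
    by move: vS; rewrite !inE => /andP[_ /h1]; rewrite ltnS leq_eqVlt (negbTE ncv).
  - by move=> v w /setD1P[_ vS] /setD1P[_ wS]; apply: h2.
  - move=> c ltc; have [v vS cv] := h3 c (ltnW ltc); exists v => //; rewrite !inE vS andbT.
    by apply/eqP=> vt; rewrite -cv vt ct ltnn in ltc.
case=> S' S'BC ->; have tS' := tNBC _ S'BC.
have [h1 h2 h3 pS' cS'] : [/\ forall v, v \in S' -> (colour v <= d)%N,
    forall v w, v \in S' -> w \in S' -> (colour v < colour w)%N ->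
      (position v < position w)%N,
    forall c, (c < d)%N -> exists2 v, v \in S' & colour v = c,
    forall v, v \in S' -> (position v < m)%N & #|S'| = s].
  case/setUP: S'BC => /boxes_belowP[/boxP[h1 h2 h3] pS' cS']; split=> //.
  - by move=> c /ltnW/h3.
  - by move=> v /h1/ltnW.
split; last by rewrite !inE eqxx.
apply/boxes_belowP; split; last by rewrite cardsU1 tS' cS'.
  apply/boxP; split.
  - by move=> v /setU1P[->|/h1]; rewrite ?ct.
  - move=> v w /setU1P[->|vS] /setU1P[->|wS]; rewrite ?ltnn ?ct ?pt //.
    + by rewrite ltnNge h1.
    + by rewrite pS'.
    + exact: h2.
  - move=> c; rewrite ltnS leq_eqVlt => /orP[/eqP->|/h3[v vS cv]].
      by exists t; rewrite // !inE eqxx.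
    by exists v; rewrite // !inE vS orbT.
by move=> v /setU1P[->|/pS'/ltnW //]; rewrite pt.
Qed.

Lemma card_boxes_below0 m s : #|boxes_below 0 m s| = (s == 0)%N.
Proof.
have box0 S : is_box 0 S -> S = set0.
  by move=> /boxP[h _ _]; apply/setP=> v; rewrite inE; apply/negP=> /h.
have [->|s0] := eqVneq s 0%N; last first.
  apply: eq_card0 => S; apply/negP => /boxes_belowP[/box0-> _ /eqP].
  by rewrite cards0 eq_sym (negbTE s0).
rewrite (_ : (0 == 0)%N = #|[set (set0 : {set 'I_N})]| :> nat); last by rewrite cards1.
apply: eq_card => S; rewrite in_set1.
apply/boxes_belowP/eqP => [[/box0] //|->].
split; rewrite ?cards0 //; last by move=> v; rewrite inE.
by apply/boxP; split=> // v; rewrite inE.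
Qed.

Lemma card_boxes_belowS0 d m : #|boxes_below d.+1 m 0| = 0%N.
Proof.
apply: eq_card0 => S; apply/negP => /boxes_belowP[/leq_card_box + _ cS].
by rewrite cS.
Qed.

Lemma card_boxes_below d m s : (d.+1 * n <= N)%N -> (m <= n)%N ->
  #|boxes_below d.+1 m s.+1| = ('C(m, s.+1) * 'C(s, d))%N.
Proof.
elim: m d s => [|m IHm] d s leN lem.
  rewrite bin0n mul0n; apply: eq_card0 => S; apply/negP.
  case/boxes_belowP=> _ pS cS.
  have /set0Pn[v /pS] : S != set0 by rewrite -card_gt0 cS.
  by rewrite ltn0.
have leN' : (d * n <= N)%N by apply: leq_trans leN; rewrite leq_mul2r leqnSn orbT.
rewrite card_boxes_below_rec // IHm ?(ltnW lem) //.
case: s d leN leN' => [|s] [|d] leN leN'.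
- by rewrite card_boxes_belowS0 card_boxes_below0 !bin1 !bin0 !muln1 addn1.
- by rewrite !card_boxes_belowS0 bin0n !muln0.
- by rewrite card_boxes_below0 IHm ?(ltnW lem) // !bin0 !muln1 addn0 binS.
- by rewrite !IHm ?(ltnW lem) // !binS; ring.
Qed.

Lemma card_boxes d l : (0 < n)%N -> (d.+1 * n <= N)%N ->
  #|boxes d.+1 l| = ('C(n, l + d.+1) * 'C(l + d, d))%N.
Proof.
move=> n_gt0 leN; rewrite addnS -card_boxes_below //.
apply: eq_card => S; rewrite !inE addnS; congr (_ && _).
by rewrite (_ : [forall v in S, _]) //; apply/forall_inP=> v _; rewrite ltn_mod.
Qed.

End Boxes.

(** * Uniqueness of the ranks of minimal resolutions *)

Lemma factor_rows (R : comNzRingType) m n p (A : 'M[R]_(m, p)) (B : 'M_(n, p)) :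
  (forall i, exists w : 'rV_n, row i A = w *m B) -> exists W, A = W *m B.
Proof.
move=> /fin_all_exists[w hw]; exists (\matrix_i w i).
by apply/row_matrixP=> i; rewrite row_mul rowK.
Qed.

Section Uniqueness.
Variables (K : fieldType) (N : nat) (I : {mpoly K[N]} -> Prop).
Local Notation R := {mpoly K[N]}.
Implicit Types F G : free_complex K N.

Local Notation at0 := (map_mx (mcoeff 0%MM)).

Lemma aug_factor m F (A : 'cV[R]_m) :
  is_resolution I F -> (forall i, I (A i 0)) -> exists W, A = W *m aug F.
Proof.
case=> hI _ _ hA; apply: factor_rows => i.
have /hI[u hu] := hA i; exists u; apply/matrixP=> a b.
by rewrite !ord1 mxE hu.
Qed.

Lemma aug_mem F i : is_resolution I F -> I (aug F i 0).
Proof.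
case=> hI _ _; apply/hI; exists (delta_mx 0 i).
by rewrite -rowE mxE.
Qed.

Lemma diff0_factor m F (A : 'M[R]_(m, rk F 0)) :
  is_resolution I F -> A *m aug F = 0 -> exists W, A = W *m diff F 0.
Proof.
case=> _ h0 _ hA; apply: factor_rows => i; apply/h0.
by rewrite -row_mul hA row0.
Qed.

Lemma diffS_factor m l F (A : 'M[R]_(m, rk F l.+1)) :
  is_resolution I F -> A *m diff F l = 0 -> exists W, A = W *m diff F l.+1.
Proof.
case=> _ _ hS hA; apply: factor_rows => i; apply/hS.
by rewrite -row_mul hA row0.
Qed.

Lemma diff_aug F : is_resolution I F -> diff F 0 *m aug F = 0.
Proof.
case=> _ h0 _; apply/row_matrixP=> i; rewrite row_mul row0.
by apply/h0; exists (delta_mx 0 i); rewrite rowE.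
Qed.

Lemma diff_diff F l : is_resolution I F -> diff F l.+1 *m diff F l = 0.
Proof.
case=> _ _ hS; apply/row_matrixP=> i; rewrite row_mul row0.
by apply/hS; exists (delta_mx 0 i); rewrite rowE.
Qed.

(** One step of the comparison between two resolutions: [a] and [a'] are
    consecutive components of a chain map from [F] to [G] lifting the identity,
    [b] and [b'] of one backwards, and [h] is the component in degree [l] of a
    homotopy from [a *m b] to the identity.  The third equation is what the
    homotopy relation in degree [l] says after composition with the
    differential; in this form it does not mention degree [l - 1], so that the
    components can be built by a plain induction. *)
Definition homotopic_lifts F G l :=
  exists (a : 'M[R]_(rk F l, rk G l)) (a' : 'M[R]_(rk F l.+1, rk G l.+1))
         (b : 'M[R]_(rk G l, rk F l)) (b' : 'M[R]_(rk G l.+1, rk F l.+1))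
         (h : 'M[R]_(rk F l, rk F l.+1)),
  [/\ a' *m diff G l = diff F l *m a, b' *m diff F l = diff G l *m b,
      diff F l *m (a *m b - 1%:M - h *m diff F l) = 0
    & at0 a *m at0 b = 1%:M].

Lemma at0_diff F l : is_minimal F -> at0 (diff F l) = 0.
Proof. by move=> hF; apply/matrixP=> i j; rewrite !mxE hF. Qed.

(** Each homotopy term has a differential of [F] as a factor, and so vanishes
    modulo the variables. *)
Lemma homotopic_liftsP F G l :
    is_resolution I F -> is_minimal F -> is_resolution I G ->
  homotopic_lifts F G l.
Proof.
move=> rF mF rG; elim: l => [|l [a [a' [b [b' [h [ea eb eh _]]]]]]].
  have [a ha] := aug_factor rG (fun i => aug_mem i rF).
  have [b hb] := aug_factor rF (fun i => aug_mem i rG).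
  have [|a' ha'] := @diff0_factor _ G (diff F 0 *m a) rG.
    by rewrite -mulmxA -ha diff_aug.
  have [|b' hb'] := @diff0_factor _ F (diff G 0 *m b) rF.
    by rewrite -mulmxA -hb diff_aug.
  have [|h hh] := @diff0_factor _ F (a *m b - 1%:M) rF.
    by rewrite mulmxBl mul1mx -mulmxA -hb -ha subrr.
  exists a, a', b, b', h; split=> //; first by rewrite hh subrr mulmx0.
  move/eqP: hh; rewrite subr_eq => /eqP/(congr1 at0).
  by rewrite map_mxD !map_mxM at0_diff // mulmx0 add0r map_mx1.
have [|a2 ha2] := @diffS_factor _ l G (diff F l.+1 *m a') rG.
  by rewrite -mulmxA ea mulmxA diff_diff // mul0mx.
have [|b2 hb2] := @diffS_factor _ l F (diff G l.+1 *m b') rF.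
  by rewrite -mulmxA eb mulmxA diff_diff // mul0mx.
have [|k hk] := @diffS_factor _ l F (a' *m b' - 1%:M - diff F l *m h) rF.
  rewrite !mulmxBl mul1mx -!mulmxA eb [a' *m _]mulmxA ea -[X in _ - X - _]mulmx1.
  by rewrite -mulmxA -!mulmxBr.
exists a', a2, b', b2, k; split=> //.
  by rewrite -hk opprB addrC subrK mulmxA diff_diff ?mul0mx.
move/eqP: hk; rewrite !subr_eq => /eqP/(congr1 at0).
rewrite !map_mxD !map_mxM !at0_diff // mulmx0 mul0mx !add0r.
by rewrite map_mx1.
Qed.

Lemma rk_minimal_resolution F G l :
    minimal_graded_free_resolution I F -> minimal_graded_free_resolution I G ->
  rk F l = rk G l.
Proof.
case=> _ rF mF [_ rG mG]; apply/eqP; rewrite eqn_leq.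
have [a [_ [b [_ [_ [_ _ _ /mulmx1_min->]]]]]] := homotopic_liftsP l rF mF rG.
by have [c [_ [d [_ [_ [_ _ _ /mulmx1_min->]]]]]] := homotopic_liftsP l rG mG rF.
Qed.

Lemma betti_eq F l : minimal_graded_free_resolution I F -> betti I l = rk F l.
Proof.
move=> hF; rewrite /betti.
have /ClassicalEpsilon.epsilon_spec : exists b, exists F,
  minimal_graded_free_resolution I F /\ rk F l = b by exists (rk F l), F.
by move=> /(_ (inhabits 0%N))[G [hG <-]]; apply: rk_minimal_resolution.
Qed.

End Uniqueness.

(** * The ideal of the diagonal *)

Lemma betti_boxes (K : fieldType) (N n d : nat) (I : {mpoly K[N]} -> Prop) l :
    (forall p, I p <-> box_ideal n d p) ->
  betti I l = #|boxes N n d l|.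
Proof.
move=> hI; apply: (@betti_eq _ _ _ (box_complex N n K d)); split.
- exact: box_complex_graded.
- exact: box_complex_resolution.
- exact: box_complex_minimal.
Qed.

Lemma ideal_gen_imset (K : fieldType) (N : nat) (T T' : finType) (A : {set T})
    (f : T -> T') (g : T -> {mpoly K[N]}) (g' : T' -> {mpoly K[N]}) :
    {in A &, injective f} -> {in A, forall t, g t = g' (f t)} ->
  forall p, ideal_gen A g p <-> ideal_gen (f @: A) g' p.
Proof.
move=> injf eqg p; split=> -[c ->].
  exists (fun t' => \sum_(t in A | f t == t') c t).
  rewrite big_imset //=; apply: eq_bigr => t tA; rewrite eqg //; congr (_ * _).
  rewrite (bigD1 t) ?tA //= big1 ?addr0 // => s /andP[/andP[sA /eqP eqf] neq].
  by rewrite (injf _ _ sA tA eqf) eqxx in neq.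
exists (c \o f); rewrite big_imset //=.
by apply: eq_bigr => t tA; rewrite eqg.
Qed.

Section Diagonal.
Variable n : nat.
Implicit Types t : 'I_n * 'I_n * 'I_n.

Definition triple_box t : {set 'I_(n + n + n)} :=
  [set lshift n (lshift n t.1.1); lshift n (rshift n t.1.2); rshift (n + n) t.2].

Lemma triple_box_inj : injective triple_box.
Proof.
have val_in v t : v \in triple_box t ->
    [\/ v = t.1.1 :> nat, v = n + t.1.2 :> nat | v = n + n + t.2 :> nat]%N.
  by rewrite !inE => /orP[/orP[]|] /eqP->; [apply: Or31|apply: Or32|apply: Or33].
move=> [[i j] k] [[i' j'] k'] eqb.
have := val_in (lshift n (lshift n i)) (i', j', k').
have := val_in (lshift n (rshift n j)) (i', j', k').
have := val_in (rshift (n + n) k) (i', j', k').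
rewrite -eqb !inE !eqxx !orbT /= => /(_ isT) hk /(_ isT) hj /(_ isT) hi.
have [lti ltj ltk] := And3 (ltn_ord i) (ltn_ord j) (ltn_ord k).
have [lti' ltj' ltk'] := And3 (ltn_ord i') (ltn_ord j') (ltn_ord k').
by congr (_, _, _); apply: val_inj; [case: hi|case: hj|case: hk] => /= ?; lia.
Qed.

Lemma colour_position_x (i : 'I_n) :
  colour n (lshift n (lshift n i)) = 0%N /\ position n (lshift n (lshift n i)) = i.
Proof. by apply: colour_position => /=. Qed.

Lemma colour_position_y (i : 'I_n) :
  colour n (lshift n (rshift n i)) = 1%N /\ position n (lshift n (rshift n i)) = i.
Proof. by apply: colour_position => //=; rewrite mul1n. Qed.

Lemma colour_position_z (i : 'I_n) :
  colour n (rshift (n + n) i) = 2 /\ position n (rshift (n + n) i) = i.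
Proof. by apply: colour_position => //=; rewrite mul2n addnn. Qed.

Lemma triple_box_is_box t :
  (t.1.1 < t.1.2 < t.2)%N -> is_box n 3 (triple_box t) /\ #|triple_box t| = 3.
Proof.
case: t => [[i j] k] /= /andP[ltij ltjk].
have [[cx px] [cy py] [cz pz]] :=
  And3 (colour_position_x i) (colour_position_y j) (colour_position_z k).
split; last first.
  rewrite /triple_box setUC cardsU1 cards2 !inE -!val_eqE /=.
  by have := ltn_ord i; have := ltn_ord j; lia.
apply/boxP; split.
- by move=> v; rewrite !inE => /orP[/orP[]|] /eqP->; rewrite ?cx ?cy ?cz.
- move=> v w; rewrite !inE => /orP[/orP[]|] /eqP-> /orP[/orP[]|] /eqP->;
    rewrite ?cx ?cy ?cz ?px ?py ?pz //.
  by move=> _; apply: ltn_trans ltjk.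
- case=> [|[|[|//]]] _; [exists (lshift n (lshift n i))
    | exists (lshift n (rshift n j)) | exists (rshift (n + n) k)];
    by rewrite ?inE ?eqxx ?orbT.
Qed.

Lemma boxes_triples :
  boxes (n + n + n) n 3 0
    = triple_box @: [set t : 'I_n * 'I_n * 'I_n | (t.1.1 < t.1.2 < t.2)%N].
Proof.
apply/setP=> S; rewrite inE add0n; apply/andP/imsetP; last first.
  by case=> t; rewrite inE => /triple_box_is_box[bt ct] ->; rewrite bt ct.
case=> /boxP[_ h2 h3] /eqP cS.
have [[u uS cu] [v vS cv] [w wS cw]] := And3 (h3 0%N isT) (h3 1%N isT) (h3 2 isT).
have lt_pos (a : 'I_(n + n + n)) : (position n a < n)%N.
  by rewrite ltn_mod; have := ltn_ord a; lia.
pose t := (Ordinal (lt_pos u), Ordinal (lt_pos v), Ordinal (lt_pos w)).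
have ltt : (t.1.1 < t.1.2 < t.2)%N by rewrite /= !h2 ?cu ?cv ?cw.
exists t; rewrite ?inE //; apply/esym/eqP.
have [_ ct] := triple_box_is_box ltt.
rewrite eqEcard ct cS leqnn andbT; apply/subsetP => a.
have [[cx px] [cy py] [cz pz]] := And3 (colour_position_x t.1.1)
  (colour_position_y t.1.2) (colour_position_z t.2).
rewrite !inE => /orP[/orP[]|] /eqP->.
- by rewrite (_ : lshift _ _ = u) //; apply: (@colour_position_inj _ n); rewrite ?cx ?px.
- by rewrite (_ : lshift _ _ = v) //; apply: (@colour_position_inj _ n); rewrite ?cy ?py.
- by rewrite (_ : rshift _ _ = w) //; apply: (@colour_position_inj _ n); rewrite ?cz ?pz.
Qed.

Lemma M_Diag_box_ideal (K : fieldType) p :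
  M_Diag K n p <-> box_ideal n 3 p.
Proof.
rewrite /M_Diag /box_ideal boxes_triples; apply: ideal_gen_imset.
  by move=> t t' _ _; apply: triple_box_inj.
move=> [[i j] k] _; rewrite /triple_box /= setUC big_setU1 /= ?big_setU1 ?big_set1 /=.
- by rewrite /xvar /yvar /zvar [LHS]mulrC.
- by rewrite inE -val_eqE /=; have := ltn_ord i; lia.
by rewrite !inE -!val_eqE /=; have := ltn_ord i; have := ltn_ord j; lia.
Qed.

End Diagonal.

(** * The binomial sum *)

(** Both sides count the pairs of disjoint subsets of sizes [m] and [l] in a set
    with [n] elements. *)
Lemma trinomial_revision n m l :
  ('C(n, m) * 'C(n - m, l) = 'C(n, l + m) * 'C(l + m, m))%N.
Proof.
have [le|lt] := leqP (l + m) n; last first.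
  rewrite (bin_small lt) mul0n; have [lt'|le'] := ltnP n m.
    by rewrite bin_small.
  by rewrite ['C(n - m, l)]bin_small ?muln0 //; lia.
have lem : (m <= n)%N by lia.
have lel : (l <= n - m)%N by lia.
have f1 := bin_fact lem; have f2 := bin_fact lel; have f3 := bin_fact le.
have := bin_fact (leq_addl l m); rewrite addnK => f4.
rewrite -subnDA [(m + l)%N]addnC in f2.
apply/eqP; rewrite -(eqn_pmul2r (_ : 0 < m`! * l`! * (n - (l + m))`!)%N); last first.
  by rewrite !muln_gt0 !fact_gt0.
apply/eqP; transitivity n`!; first by rewrite -f1 -f2; ring.
by rewrite -f3 -f4; ring.
Qed.

Lemma sum_binomials n l :
  (\sum_(3 <= k < n.+1) 'C(k.-1, 2) * 'C(k - 3, l) = 'C(n, l + 3) * 'C(l + 2, 2))%N.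
Proof.
elim: n => [|n IHn]; first by rewrite big_geq // addn3 bin0n.
have [lt|le] := ltnP n 2.
  by rewrite big_geq ?(bin_small (_ : n.+1 < l + 3)%N) //; lia.
rewrite big_nat_recr //= IHn addnS binS mulnDl; congr (_ + _)%N.
by rewrite subSS trinomial_revision addnS.
Qed.

Theorem corollary1 (K : fieldType) (n : nat) (hn : (3 <= n)%N) (l : nat) :
  betti (M_Diag K n) l =
    (\sum_(3 <= k < n.+1) 'C(k.-1, 2) * 'C(k - 3, l))%N.
Proof.
rewrite (betti_boxes (n := n) l (@M_Diag_box_ideal n K)) card_boxes.
- by rewrite sum_binomials.
- by lia.
- by rewrite !mulSn mul0n; lia.
Qed.
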